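(* Let $(L,\alpha)\in\mathcal K$. Define $$\bar g(s)=\xi'(s)+h^2-\int_0^s\frac{dq}{\big(L-\int_0^q\alpha(r)dr\big)^2},\quad s\in[0,1],\qquad g(u)=\int_u^1\bar g(s)ds,\quad u\in[0,1].$$ Let $\nu$ be the measure on $[0,1)$ induced by $\alpha$, i.e. $\nu([0,s])=\alpha(s)$ for $s\in[0,1)$, and let $S=\{u\in[0,1):g(u)=0\}$. Then $(L,\alpha)$ is the minimizer of $\mathcal Q$ over $\mathcal K$ if and only if $$\xi'(1)+h^2=\int_0^1\frac{dq}{\big(L-\int_0^q\alpha(r)dr\big)^2},$$ $\min_{u\in[0,1]}g(u)\ge0$, and $\nu(S)=\nu([0,1))$.
   Context: Let $(\gamma_p)_{p\ge2}$ be real numbers with $\sum_{p\ge2}2^p\gamma_p^2<\infty$, $h\in\mathbb R$, and $\xi(s)=\sum_{p\ge2}\gamma_p^2s^p$. $\mathcal N$ is the set of nonnegative, nondecreasing, right-continuous functions on $[0,1)$; $\mathcal K=\{(L,\alpha)\in(0,\infty)\times\mathcal N: L>\int_0^1\alpha(s)ds\}$; for $(L,\alpha)\in\mathcal K$, $$\mathcal Q(L,\alpha)=\frac12\Big((\xi'(1)+h^2)L-\int_0^1\xi''(q)\Big(\int_0^q\alpha(s)ds\Big)dq+\int_0^1\frac{dq}{L-\int_0^q\alpha(s)ds}\Big).$$ $\mathcal Q$ has a unique minimizer over $\mathcal K$ (this minimizer is what ''the minimizer'' refers to). *)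

(* Defs.v *)
From HB Require Import structures.
From mathcomp Require Import all_boot all_order all_algebra.
From mathcomp Require Import all_classical all_reals all_analysis.
Set Implicit Arguments. Unset Strict Implicit. Unset Printing Implicit Defensive.
Import Order.TTheory GRing.Theory Num.Theory.
Import numFieldNormedType.Exports.
Local Open Scope classical_set_scope.
Local Open Scope ring_scope.

Section Parisi.
Variable R : realType.

Definition xi (gamma : nat -> R) (s : R) : R :=
  limn (fun n => \sum_(2 <= p < n) gamma p ^+ 2 * s ^+ p).

Definition summable_gamma (gamma : nat -> R) : Prop :=
  cvgn (fun n => \sum_(2 <= p < n) 2 ^+ p * gamma p ^+ 2).

Definition xi' (gamma : nat -> R) : R -> R := derive1 (xi gamma).
Definition xi'' (gamma : nat -> R) : R -> R := derive1 (derive1 (xi gamma)).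

Definition Aint (alpha : R -> R) (q : R) : \bar R :=
  (\int[lebesgue_measure]_(s in `[0%R, q[) (alpha s)%:E)%E.

Definition A (alpha : R -> R) (q : R) : R := fine (Aint alpha q).

Definition in_N (alpha : R -> R) : Prop :=
  [/\ (forall s, 0 <= s < 1 -> 0 <= alpha s),
      (forall s t, 0 <= s -> s <= t -> t < 1 -> alpha s <= alpha t) &
      (forall s, 0 <= s < 1 -> alpha x @[x --> s^'+] --> alpha s)].

Definition in_K (L : R) (alpha : R -> R) : Prop :=
  [/\ 0 < L, in_N alpha & (Aint alpha 1 < L%:E)%E].

Definition Qfun (gamma : nat -> R) (h L : R) (alpha : R -> R) : R :=
  2^-1 * ((xi' gamma 1 + h ^+ 2) * L
          - (\int[lebesgue_measure]_(q in `[0, 1]) (xi'' gamma q * A alpha q))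
          + (\int[lebesgue_measure]_(q in `[0, 1]) (L - A alpha q)^-1)).

Definition is_minimizer (gamma : nat -> R) (h L : R) (alpha : R -> R) : Prop :=
  in_K L alpha /\
  forall L' alpha', in_K L' alpha' -> Qfun gamma h L alpha <= Qfun gamma h L' alpha'.

Definition gbar (gamma : nat -> R) (h L : R) (alpha : R -> R) (s : R) : R :=
  xi' gamma s + h ^+ 2
  - \int[lebesgue_measure]_(q in `[0, s]) ((L - A alpha q) ^+ 2)^-1.

Definition gfun (gamma : nat -> R) (h L : R) (alpha : R -> R) (u : R) : R :=
  \int[lebesgue_measure]_(s in `[u, 1]) gbar gamma h L alpha s.

Definition Sset (gamma : nat -> R) (h L : R) (alpha : R -> R) : set R :=
  [set u | 0 <= u < 1 /\ gfun gamma h L alpha u = 0].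

End Parisi.

(* Main.v *)
Require Import Defs.
From HB Require Import structures.
From mathcomp Require Import all_boot all_order all_algebra.
From mathcomp Require Import all_classical all_reals all_analysis.
From mathcomp Require Import measurable_realfun ring lra.
Import Order.TTheory GRing.Theory Num.Theory.
Import numFieldNormedType.Exports.
Local Open Scope classical_set_scope.
Local Open Scope ring_scope.
Set Implicit Arguments. Unset Strict Implicit. Unset Printing Implicit Defensive.

(** [Q] is convex, so minimality amounts to the first-order conditions. With [A] the primitive of
    [alpha], the derivative of [2 Q] in a direction [(l, a)] is [l gbar(1) + int A_a g''], where
    [g'' = (L - A)^-2 - xi'']. The directions [(+1, 0)] and [(-1, 0)] give [gbar(1) = 0]; Fubini
    then turns [int A_a g''] into [int a gbar], which is [g(u)] for [a] the indicator of [[u, 1)]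
    and [int g dnu] for [a = alpha]. Hence the directions [1_[u,1)] and [- alpha] yield [g >= 0] and
    [int g dnu <= 0], i.e. [g = 0] nu-almost everywhere, and conversely these conditions make the
    derivative towards any competitor nonnegative.

    When [nu([0, 1))] is infinite, [nu(S) = nu([0, 1))] does not by itself give
    [nu([0, 1) \ S) = 0]. But then [alpha] is unbounded and [g''] is strictly increasing near [1],
    which keeps [S] away from [1], so that [nu(S)] is finite: this case does not occur. *)

(** * Termwise differentiation of power series with nonnegative coefficients *)

Section PowerSeries.
Context {R : realType}.
Implicit Types (c : R^nat) (x K : R).

(** Convergence at every nonnegative point below 2 puts [1], where [xi'] is evaluated, in the
    interior of the disc. Nonnegative coefficients allow comparison of series without absolute
    values. *)
Definition radius2 c :=
  (forall n, 0 <= c n) /\ (forall K, 0 <= K < 2 -> cvgn (pseries c K)).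

(** A mean value inequality for [x ^+ n.+1]. It bounds [n.+1%:R * K ^+ n] by [K1 ^+ n.+1 / (K1 - K)]
    when [K < K1], so that the differentiated series at [K] is dominated by the original one at
    [K1]. *)
Lemma expr_diff_lower (K K1 : R) n : 0 <= K <= K1 ->
  n.+1%:R * K ^+ n * (K1 - K) <= K1 ^+ n.+1 - K ^+ n.+1.
Proof.
move=> /andP[K0 KK1]; elim: n => [|n IHn].
  by rewrite expr0 !expr1 !mul1r.
have /(ler_wpM2l K0) := IHn.
have : 0 <= (K1 - K) * (K1 ^+ n.+1 - K ^+ n.+1).
  by rewrite mulr_ge0 ?subr_ge0// ler_pXn2r ?nnegrE// (le_trans K0).
rewrite -[n.+2%:R]natr1 !exprS.
set a := K ^+ n; set b := K1 ^+ n; set m := n.+1%:R.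
move=> h1 h2.
rewrite (_ : (m + 1) * (K * a) * (K1 - K) =
  K * (m * a * (K1 - K)) + K * a * (K1 - K)); last by ring.
lra.
Qed.

Lemma cvg_series_shift (u : R^nat) :
  cvgn (series u) -> cvgn (series (fun n => u n.+1)).
Proof.
move=> cu; have -> : series (fun n => u n.+1) = (fun n => series u n.+1 - u 0%N).
  apply/funext => n; rewrite /series/= [in RHS]big_nat_recl//=.
  by rewrite addrC addKr.
apply/cvg_ex; exists (limn (series u) - u 0%N).
by apply: cvgB; [rewrite (cvg_shiftS (series u))|exact: cvg_cst].
Qed.

Lemma radius2_diffs c : radius2 c -> radius2 (pseries_diffs c).
Proof.
move=> [c0 cc]; split=> [n|K /andP[K0 K2]].
  by rewrite /pseries_diffs mulr_ge0.
(* The midpoint of [K] and 2 leaves room above [K] while the original series still converges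
   there. *)
pose K1 : R := (K + 2) / 2.
have KK1 : K < K1 by rewrite /K1; lra.
have K12 : K1 < 2 by rewrite /K1; lra.
have K10 : 0 <= K1 by rewrite /K1; lra.
apply: (@series_le_cvg _ _ (fun n => (K1 - K)^-1 * (c n.+1 * K1 ^+ n.+1))).
- by move=> n; rewrite /pseries_diffs !mulr_ge0// exprn_ge0.
- by move=> n; rewrite !mulr_ge0 ?invr_ge0 ?subr_ge0 ?(ltW KK1)// exprn_ge0.
- move=> n; rewrite /pseries_diffs ler_pdivlMl ?subr_gt0//.
  have := @expr_diff_lower K K1 n; rewrite K0 (ltW KK1) => /(_ isT) h.
  have {h} h : n.+1%:R * K ^+ n * (K1 - K) <= K1 ^+ n.+1.
    by apply: (le_trans h); rewrite gerBl exprn_ge0.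
  have := ler_wpM2l (c0 n.+1) h.
  rewrite [X in X <= _](_ : _ = (K1 - K) * (n.+1%:R * c n.+1 * K ^+ n))//.
  by ring.
- apply: is_cvg_seriesZ.
  apply: (@cvg_series_shift (fun n => c n * K1 ^+ n)); apply: cc.
  by rewrite K10 K12.
Qed.

(** [pseries_snd_diffs] asks for convergence of the series and of its first two formal derivatives
    at some point beyond [|x|]; the midpoint of [|x|] and 2 serves, and [radius2_diffs] applies
    twice. *)
Lemma radius2_is_derive c x : radius2 c -> `|x| < 2 ->
  is_derive x (1 : R) (fun x => limn (pseries c x))
    (limn (pseries (pseries_diffs c) x)).
Proof.
move=> rc x2; pose K : R := (`|x| + 2) / 2.
have x0 : 0 <= `|x| by [].
have K2 : 0 <= K < 2 by rewrite /K; apply/andP; split; lra.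
apply: (@pseries_snd_diffs _ c K).
- exact: rc.2.
- exact: (radius2_diffs rc).2.
- exact: (radius2_diffs (radius2_diffs rc)).2.
- by rewrite (ger0_norm (andP K2).1) /K; lra.
Qed.

End PowerSeries.

(** * Derivatives of [xi] on the disc of radius 2 *)

Section Xi.
Context {R : realType} (gamma : R^nat).
Hypothesis gammaS : summable_gamma gamma.

(** Zero coefficients below 2 turn the sum that starts at [p = 2] into a genuine power series. *)
Let c : R^nat := fun p => if (p < 2)%N then 0 else gamma p ^+ 2.

Let xi_seriesE (s : R) :
  (fun n => \sum_(2 <= p < n) gamma p ^+ 2 * s ^+ p) = pseries c s.
Proof.
apply/funext => n; rewrite /pseries /series/=.
have [n2|n2] := ltnP n 2.
  rewrite big_geq ?(ltnW n2)// big_nat big1// => i /andP[_ ni].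
  by rewrite /c (ltn_trans ni n2) mul0r.
rewrite [RHS](@big_cat_nat _ _ _ 2)//= [X in X + _]big_nat [X in X + _]big1 ?add0r.
  by apply: eq_big_nat => i /andP[i2 _]; rewrite /c ltnNge i2.
by move=> i /andP[_ i2]; rewrite /c i2 mul0r.
Qed.

Let radius2_c : radius2 c.
Proof.
split=> [n|K /andP[K0 K2]]; first by rewrite /c; case: ifP => // _; rewrite sqr_ge0.
(* The summability hypothesis is convergence at the point 2 itself. *)
apply: (@is_cvg_pseries_inside _ _ 2); last by rewrite !ger0_norm.
rewrite -xi_seriesE; move: gammaS; rewrite /summable_gamma.
by under eq_fun do under eq_bigr do rewrite mulrC.
Qed.

(** The candidate for the derivative of order [j] of [xi], obtained termwise. *)
Let X j x := limn (pseries (iter j (@pseries_diffs R) c) x).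

Let X_is_derive j (x : R) : `|x| < 2 -> is_derive x (1 : R) (X j) (X j.+1 x).
Proof.
move=> x2; apply: radius2_is_derive => //.
by elim: j => //= j; exact: radius2_diffs.
Qed.

(** A derivative is local and the disc is open, so agreement on [|x| < 2] is enough. This form can
    be iterated through the [derive1] in [xi'] and [xi'']. *)
Let X_derive1 j (f : R -> R) : (forall x, `|x| < 2 -> f x = X j x) ->
  forall x, `|x| < 2 -> is_derive x (1 : R) f (X j.+1 x).
Proof.
move=> fX x x2; apply: (@near_eq_is_derive _ _ _ (X j)); last exact: X_is_derive.
have : \forall y \near x, `|y| < 2.
  apply: (@cvgr_lt _ _ (nbhs x) _ Num.norm `|x|) => //.
  by apply: cvg_norm; exact: cvg_id.
by apply: filterS => y /fX ->.
Qed.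

Let derive1_X j (f : R -> R) : (forall x, `|x| < 2 -> f x = X j x) ->
  forall x, `|x| < 2 -> derive1 f x = X j.+1 x.
Proof.
by move=> fX x x2; rewrite derive1E; apply: derive_val; exact: X_derive1.
Qed.

Let xiE x : `|x| < 2 -> xi gamma x = X 0 x.
Proof. by move=> _; rewrite /xi xi_seriesE. Qed.

Let xi'E x : `|x| < 2 -> xi' gamma x = X 1 x.
Proof. exact: derive1_X xiE x. Qed.

Let xi''E x : `|x| < 2 -> xi'' gamma x = X 2 x.
Proof. exact: derive1_X xi'E x. Qed.

Lemma xi'_is_derive (x : R) : `|x| < 2 -> is_derive x (1 : R) (xi' gamma) (xi'' gamma x).
Proof. by move=> x2; rewrite xi''E//; exact: X_derive1 xi'E _ _. Qed.

Let norm_itv01 (x : R) : x \in `[0, 1] -> `|x| < 2.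
Proof.
by rewrite in_itv/= => /andP[x0 x1]; rewrite ger0_norm// (le_lt_trans x1)// ltr1n.
Qed.

Lemma xi'_continuous : {within `[0, 1], continuous (xi' gamma)}.
Proof.
apply: derivable_within_continuous => x /norm_itv01 x2.
by have [] := xi'_is_derive x2.
Qed.

Lemma xi''_continuous : {within `[0, 1], continuous (xi'' gamma)}.
Proof.
apply: derivable_within_continuous => x /norm_itv01 x2.
by have [] := X_derive1 xi''E x2.
Qed.

(** The third derivative is continuous, hence bounded above on [[0, 1]], and the mean value theorem
    applies. The bound is later compared with the growth of [gapV2]. *)
Lemma xi''_lipschitz : exists2 C, 0 < C & forall s t, 0 <= s -> s <= t -> t <= 1 ->
  xi'' gamma t - xi'' gamma s <= C * (t - s).
Proof.
have cX3 : {within `[0, 1], continuous (X 3)}.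
  by apply: derivable_within_continuous => x /norm_itv01 x2; have [] := X_is_derive 3 x2.
have [m m01 Mx] := EVT_max ler01 cX3.
exists (`|X 3 m| + 1); first by rewrite ltr_wpDl.
move=> s t s0 st t1.
have st01 x : x \in `[s, t] -> x \in `[0, 1].
  by rewrite !in_itv/= => /andP[sx xt]; rewrite (le_trans s0 sx) (le_trans xt).
have [||z /st01 z01 ->] := @MVT_segment _ (xi'' gamma) (X 3) s t st.
- move=> x xst; apply: (X_derive1 xi''E); apply: norm_itv01; apply: st01.
  exact: subset_itv_oo_cc.
- by apply: derivable_within_continuous => x /st01/norm_itv01 x2; have [] := X_derive1 xi''E x2.
- rewrite ler_wpM2r ?subr_ge0// (le_trans (Mx _ z01))//.
  by rewrite (le_trans (ler_norm _))// lerDl.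
Qed.

End Xi.

(** * Measurability of monotone functions and a weighted Fubini formula *)

Section Measure.
Context {R : realType}.
Notation mu := (@lebesgue_measure R).

(** The preimage of a ray [[r, +oo[] under a monotone function is an interval. *)
Lemma itv_nondecreasing_measurable (i : interval R) (f : R -> R) :
  {in i &, {homo f : x y / x <= y}} -> measurable_fun [set` i] f.
Proof.
move=> f_nd; have mD : measurable [set` i] by exact: measurable_itv.
apply: (measurability (@RGenCInfty.G R)) => [|/= _ [_] [r] -> <-].
  exact: RGenCInfty.measurableE.
apply: is_interval_measurable => s t [/= si] + [/= ti] + u /andP[su ut].
rewrite in_itv/= andbT => fs _.
have ui : u \in i by have := @interval_is_interval _ i s t si ti u; apply; apply/andP; split.
by split => //=; rewrite in_itv/= andbT (le_trans fs)// f_nd.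
Qed.

(* [a s] is the [b]-weighted [nu]-measure of the section of [E] at [s]. This covers the primitive
   of a density, the layer-cake formula and the distribution function of a measure. *)
Lemma weighted_fubini d (T : measurableType d) (nu : {sigma_finite_measure set T -> \bar R})
    (f a : R -> R) (b : T -> R) (E : set (R * T)) (C : R) :
  measurable E -> mu.-integrable setT (EFin \o f) -> (forall s, `|f s| <= C) ->
  measurable_fun setT b -> (forall t, 0 <= b t) ->
  mu.-integrable setT (EFin \o a) ->
  (forall s, f s != 0 -> (a s)%:E = (\int[nu]_t (b t * \1_E (s, t))%:E)%E) ->
  nu.-integrable setT (fun t => (b t * \int[mu]_s (f s * \1_E (s, t)))%:E) /\
  (\int[nu]_t (b t * \int[mu]_s (f s * \1_E (s, t)))%:E =
   \int[mu]_s (f s * a s)%:E)%E.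
Proof.
move=> mE intf fC mb b0 inta aE.
have mf : measurable_fun setT f by apply/measurable_EFinP; exact: measurable_int intf.
have ma : measurable_fun setT a by apply/measurable_EFinP; exact: measurable_int inta.
have mE1 s : measurable_fun setT (fun t => \1_E (s, t) : R).
  by apply: (measurableT_comp (measurable_indic mE)); exact: measurable_pair1.
have mE2 t : measurable_fun setT (fun s => \1_E (s, t) : R).
  by apply: (measurableT_comp (measurable_indic mE)); exact: measurable_pair2.
have mbE s : measurable_fun setT (fun t => b t * \1_E (s, t)) by apply: measurable_funM.
have bE0 s t : 0 <= b t * \1_E (s, t) by rewrite mulr_ge0// indicE.
pose F z := (f z.1 * (b z.2 * \1_E z))%:E.
have mF : measurable_fun setT F.
  apply/measurable_EFinP; apply: measurable_funM.
    exact: (measurableT_comp mf).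
  apply: measurable_funM; last exact: measurable_indic.
  exact: (measurableT_comp mb).
have intfa : mu.-integrable setT (fun s => (f s * a s)%:E).
  apply: (le_integrable measurableT _ _ (integrableZl measurableT C inta)).
  - by apply/measurable_EFinP; exact: measurable_funM.
  - move=> s _; rewrite /= lee_fin !normrM ler_wpM2r//.
    exact: (le_trans (fC s) (ler_norm _)).
(* The inner integral of the absolute value, from which integrability on the product follows. Where
   [f] vanishes [aE] says nothing, but both sides are 0. *)
have absF s : (\int[nu]_t `|F (s, t)| = `|(f s * a s)%:E|)%E.
  have [f0|f0] := eqVneq (f s) 0.
    rewrite f0 mul0r abse0 integral0_eq// => t _.
    by rewrite /F/= f0 mul0r normr0.
  have as0 : 0 <= a s.
    by rewrite -lee_fin aE// integral_ge0// => t _; rewrite lee_fin.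
  under eq_integral do rewrite /F/= normrM (ger0_norm (bE0 _ _)) EFinM.
  rewrite ge0_integralZl//; last 2 first.
  - exact/measurable_EFinP.
  - by move=> t _; rewrite lee_fin.
  by rewrite -aE// /= normrM (ger0_norm as0).
have intF : (mu \x nu)%E.-integrable setT F.
  apply/(integrable12ltyP mu nu mF); under eq_integral do rewrite absF.
  by have /integrableP[] := intfa.
have FE s : (\int[nu]_t F (s, t) = (f s * a s)%:E)%E.
  have [f0|f0] := eqVneq (f s) 0.
    by rewrite f0 mul0r integral0_eq// => t _; rewrite /F/= f0 mul0r.
  rewrite /F/=; under eq_integral do rewrite EFinM.
  rewrite integralZl//=; first by rewrite -aE.
  apply/integrableP; split; first exact/measurable_EFinP.
  under eq_integral do rewrite /= ger0_norm//.
  by rewrite -aE// ltry.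
have intfE t : mu.-integrable setT (fun s => (f s * \1_E (s, t))%:E).
  apply: (le_integrable measurableT _ _ intf).
    by apply/measurable_EFinP; apply: (measurable_funM mf (mE2 t)).
  move=> s _; rewrite /= lee_fin normrM indicE.
  by rewrite ler_piMr// normr_nat lern1 leq_b1.
have GE t : (\int[mu]_s F (s, t) = (b t * \int[mu]_s (f s * \1_E (s, t)))%:E)%E.
  rewrite EFinM /Rintegral fineK; last exact: integrable_fin_num.
  rewrite -integralZl//; apply: eq_integral => s _.
  by rewrite /F/= -EFinM; congr EFin; ring.
split.
  under eq_fun do rewrite -GE.
  apply/integrableP; split; first exact: measurable_fubini_G intF.
  have /(integrable21ltyP mu nu mF) := intF; apply: le_lt_trans.
  apply: ge0_le_integral => //.
  - by apply: measurableT_comp => //; exact: measurable_fubini_G intF.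
  - apply: (@measurable_fun_fubini_tonelli_G _ _ _ _ _ mu (abse \o F)); last first.
      by move=> t; exact: abse_ge0.
    exact: measurableT_comp.
  - move=> t _; apply: le_abse_integral => //.
    exact: (measurableT_comp mF (measurable_pair2 t)).
under eq_integral do rewrite -GE.
by rewrite -(Fubini intF); apply: eq_integral => s _; rewrite FE.
Qed.
End Measure.

(** * Bounded measurable functions on [[0, 1]] and their tail integrals *)

Section Bounded.
Context {R : realType}.
Notation mu := (@lebesgue_measure R).
Implicit Types f g : R -> R.

(** A class closed under the ring operations and containing continuous and monotone functions, so
    that integrability on subintervals of [[0, 1]] becomes a closure property. *)
Definition bdd01 f := measurable_fun (`[0%R, 1%R]%classic : set R) f /\
  exists C, forall x, 0 <= x <= 1 -> `|f x| <= C.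

Lemma lebesgue_itv01_lty : (mu `[0%R, 1%R]%classic < +oo)%E.
Proof. by rewrite lebesgue_measure_itv/= lte01 -EFinD ltry. Qed.

Lemma bdd01_integrable f : bdd01 f -> mu.-integrable `[0, 1] (EFin \o f).
Proof.
move=> [mf [C fC]]; apply: measurable_bounded_integrable => //.
  exact: lebesgue_itv01_lty.
exists C; split; first exact: num_real.
by move=> M CM x /=; rewrite in_itv/= => /fC /le_trans; apply; exact: ltW.
Qed.

Lemma bdd01_integrableS f (i : interval R) : (i <= `[0, 1])%O -> bdd01 f ->
  mu.-integrable [set` i] (EFin \o f).
Proof.
move=> i01 /bdd01_integrable; apply: integrableS => //.
by move=> x /=; exact: subitvP.
Qed.

Lemma bdd01_cst (c : R) : bdd01 (cst c).
Proof. by split; [exact: measurable_cst|exists `|c|]. Qed.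

Lemma bdd01D f g : bdd01 f -> bdd01 g -> bdd01 (fun x => f x + g x).
Proof.
move=> [mf [C fC]] [mg [D gD]]; split; first exact: measurable_funD.
by exists (C + D) => x x01; rewrite (le_trans (ler_normD _ _))// lerD ?fC ?gD.
Qed.

Lemma bdd01M f g : bdd01 f -> bdd01 g -> bdd01 (fun x => f x * g x).
Proof.
move=> [mf [C fC]] [mg [D gD]]; split; first exact: measurable_funM.
by exists (C * D) => x x01; rewrite normrM ler_pM ?fC ?gD.
Qed.

Lemma bdd01N f : bdd01 f -> bdd01 (fun x => - f x).
Proof.
move=> [mf [C fC]]; split; first exact: measurable_funN.
by exists C => x x01; rewrite normrN fC.
Qed.

Lemma bdd01B f g : bdd01 f -> bdd01 g -> bdd01 (fun x => f x - g x).
Proof. by move=> bf bg; apply: bdd01D => //; exact: bdd01N. Qed.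

Lemma bdd01_continuous f : {within `[0, 1], continuous f} -> bdd01 f.
Proof.
move=> cf; split; first by apply: subspace_continuous_measurable_fun => //.
have [M _ fM] := EVT_max ler01 cf; have [m _ fm] := EVT_min ler01 cf.
exists (Num.max `|f M| `|f m|) => x x01; rewrite ler_norml; apply/andP; split.
  rewrite lerNl le_max; apply/orP; right; rewrite (@le_trans _ _ (- f m))//.
    by rewrite lerN2 fm// in_itv.
  by rewrite -normrN ler_norm.
by rewrite le_max (le_trans (fM _ _) (ler_norm _))// in_itv.
Qed.

Lemma bdd01_nondecreasing f :
  (forall s t, 0 <= s -> s <= t -> t <= 1 -> f s <= f t) -> bdd01 f.
Proof.
move=> fnd; split.
  apply: itv_nondecreasing_measurable => s t.
  by rewrite !in_itv/= => /andP[s0 _] /andP[_ t1] st; exact: fnd.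
exists (Num.max `|f 1| `|f 0|) => x /andP[x0 x1]; rewrite ler_norml; apply/andP; split.
  rewrite lerNl le_max; apply/orP; right; rewrite (@le_trans _ _ (- f 0))//.
    by rewrite lerN2 fnd.
  by rewrite -normrN ler_norm.
by rewrite le_max (le_trans (fnd _ _ _ _ _) (ler_norm _)).
Qed.

Lemma le_Rintegral01 f g : bdd01 f -> bdd01 g ->
  (forall x, 0 <= x <= 1 -> f x <= g x) ->
  \int[mu]_(x in `[0, 1]) f x <= \int[mu]_(x in `[0, 1]) g x.
Proof.
move=> bf bg fg; by apply: le_Rintegral => //; exact: bdd01_integrable.
Qed.

Lemma Rintegral01D f g : bdd01 f -> bdd01 g ->
  \int[mu]_(x in `[0, 1]) (f x + g x) =
  \int[mu]_(x in `[0, 1]) f x + \int[mu]_(x in `[0, 1]) g x.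
Proof. by move=> bf bg; apply: RintegralD => //; exact: bdd01_integrable. Qed.

Lemma Rintegral01B f g : bdd01 f -> bdd01 g ->
  \int[mu]_(x in `[0, 1]) (f x - g x) =
  \int[mu]_(x in `[0, 1]) f x - \int[mu]_(x in `[0, 1]) g x.
Proof. by move=> bf bg; apply: RintegralB => //; exact: bdd01_integrable. Qed.

Lemma Rintegral01Z f c : bdd01 f ->
  \int[mu]_(x in `[0, 1]) (c * f x) = c * \int[mu]_(x in `[0, 1]) f x.
Proof. by move=> bf; apply: RintegralZl => //; exact: bdd01_integrable. Qed.

Lemma Rintegral01_cst (c : R) : \int[mu]_(x in `[0, 1]) c = c.
Proof.
rewrite Rintegral_cst// [X in fine X](_ : _ = 1%E) ?mulr1//.
by rewrite [LHS]lebesgue_measure_itv/= lte01 oppr0 adde0.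
Qed.

(** [gfun] is the tail integral of [gbar], and [gbar] is that of [kappa] up to the constant
    [gbar 1]. *)
Definition tail_int f (u : R) := \int[mu]_(s in `[u, 1]) f s.

Lemma tail_int1 f : tail_int f 1 = 0.
Proof. by rewrite /tail_int set_itv1 Rintegral_set1. Qed.

Lemma tail_int_bndo f u : bdd01 f -> 0 <= u ->
  \int[mu]_(s in `[u, 1[) f s = tail_int f u.
Proof.
move=> bf u0; rewrite Rintegral_itv_bndo_bndc//.
by apply: bdd01_integrableS => //; rewrite subitvE !bnd_simp u0/=.
Qed.

Lemma tail_int_oo f u : bdd01 f -> 0 <= u ->
  \int[mu]_(s in `]u, 1[) f s = tail_int f u.
Proof.
move=> bf u0; rewrite -tail_int_bndo// Rintegral_itv_obnd_cbnd//.
by apply: bdd01_integrableS => //; rewrite subitvE !bnd_simp u0/=.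
Qed.

(** Recasts the integrands of [weighted_fubini] as [f] restricted to a section of [E]. *)
Lemma patch_indicM f (T : Type) (D D' : set R) (E : set T) s z :
  (D s /\ E z <-> D' s) -> (f \_ D) s * \1_E z = (f \_ D') s.
Proof.
move=> DE; rewrite !patchE indicE.
have -> : (s \in D') = (s \in D) && (z \in E).
  apply/idP/andP => [|[]]; rewrite !inE; first by move/DE => -[].
  by move=> Ds Ez; apply/DE.
by case: (s \in D); case: (z \in E); rewrite ?(mulr1, mulr0, mul0r).
Qed.

Lemma bdd01_patch f : bdd01 f -> mu.-integrable setT (EFin \o (f \_ `[0, 1[)) /\
  exists C, forall s, `|(f \_ `[0, 1[) s| <= C.
Proof.
move=> bf; split.
  rewrite -restrict_EFin; apply/integrable_restrict => //=; rewrite setTI.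
  by apply: bdd01_integrableS => //; rewrite subitvE !bnd_simp.
have [_ [C fC]] := bf; exists (Num.max C 0) => s; rewrite patchE.
case: ifPn => [|_]; last by rewrite normr0 le_max lexx orbT.
by rewrite inE/= in_itv/= => /andP[s0 s1]; rewrite le_max fC// s0 ltW.
Qed.

End Bounded.

(** * The primitive of [alpha], and integrals against [alpha] as a density *)

Section Density.
Context {R : realType}.
Notation mu := (@lebesgue_measure R).
Variable alpha : R -> R.
Hypothesis aN : in_N alpha.
Hypothesis aI : (Aint alpha 1 < +oo)%E.

Let a0 s : 0 <= s < 1 -> 0 <= alpha s. Proof. by have [h _ _] := aN; exact: h. Qed.

Let and s t : 0 <= s -> s <= t -> t < 1 -> alpha s <= alpha t.
Proof. by have [_ h _] := aN; exact: h. Qed.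

Lemma in_N_integrable : mu.-integrable `[0, 1[ (EFin \o alpha).
Proof.
apply/integrableP; split.
  apply/measurable_EFinP; apply: itv_nondecreasing_measurable => s t.
  by rewrite !in_itv/= => /andP[s0 _] /andP[_ t1] st; exact: and.
rewrite [X in (X < _)%E](_ : _ = Aint alpha 1)//; apply: eq_integral => s.
by rewrite inE/= in_itv/= => s01; rewrite ger0_norm ?a0.
Qed.

Lemma A_sub p q : 0 <= p -> p <= q -> q <= 1 ->
  A alpha q - A alpha p = \int[mu]_(s in `[p, q[) alpha s.
Proof.
move=> p0 pq q1; rewrite /A /Aint -/(Rintegral mu _ alpha) -/(Rintegral mu _ alpha).
rewrite (@itv_bndbnd_setU _ _ _ (BLeft p)) ?bnd_simp// Rintegral_setU//=.
- by rewrite addrC addKr.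
- rewrite -itv_bndbnd_setU ?bnd_simp//; apply: integrableS in_N_integrable => //.
  by move=> x /=; apply: subitvP; rewrite subitvE !bnd_simp.
- apply/disj_setPS => y [/=]; rewrite 2!in_itv/= => /andP[_ yx] /andP[].
  by rewrite leNgt yx.
Qed.

Lemma A0 : A alpha 0 = 0.
Proof. by rewrite /A /Aint set_itvco0 integral_set0. Qed.

Lemma A_nondecreasing p q : 0 <= p -> p <= q -> q <= 1 -> A alpha p <= A alpha q.
Proof.
move=> p0 pq q1; rewrite -subr_ge0 A_sub//; apply: Rintegral_ge0 => s /=.
rewrite in_itv/= => /andP[ps sq]; apply: a0.
by rewrite (le_trans p0 ps) (lt_le_trans sq).
Qed.

Lemma A_ge0 q : 0 <= q -> q <= 1 -> 0 <= A alpha q.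
Proof. by move=> q0 q1; rewrite -A0 A_nondecreasing. Qed.

Lemma bdd01_A : bdd01 (A alpha).
Proof. by apply: bdd01_nondecreasing => s t; exact: A_nondecreasing. Qed.

Let b := alpha \_ `[0, 1[.

Let b_int : mu.-integrable setT (EFin \o b).
Proof.
rewrite -restrict_EFin; apply/integrable_restrict => //=; rewrite setTI.
exact: in_N_integrable.
Qed.

Let mb : measurable_fun setT b.
Proof. by apply/measurable_EFinP; exact: measurable_int b_int. Qed.

Let b_ge0 t : 0 <= b t.
Proof. by rewrite /b patchE; case: ifPn => //; rewrite inE/= in_itv/=; exact: a0. Qed.

Let int01M f g : \int[mu]_(s in `[0, 1[) (f s * g s) =
  fine (\int[mu]_s ((f \_ `[0, 1[) s * (g \_ `[0, 1[) s)%:E)%E.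
Proof.
rewrite Rintegral_mkcond; congr fine; apply: eq_integral => s _; congr EFin.
by rewrite !patchE; case: ifP => // _; rewrite mulr0.
Qed.

(** Exchange of the order of integration on the triangle [s < q], since [A alpha q] integrates
    [alpha] over the section at [q]. *)
Lemma Rintegral_A_tail k : bdd01 k ->
  \int[mu]_(q in `[0, 1]) (A alpha q * k q) =
  \int[mu]_(s in `[0, 1[) (alpha s * tail_int k s).
Proof.
move=> bk; have [kint [C kC]] := bdd01_patch bk.
have [aint _] := bdd01_patch bdd01_A.
pose E := (fun z : R * R => z.1 - z.2) @^-1` `]0, +oo[.
have Eq q s : E (q, s) <-> s < q by rewrite /E/= in_itv/= andbT subr_gt0.
have mE : measurable E.
  rewrite -[E]setTI; apply: measurable_funB => //.
have [|_ H] := @weighted_fubini R _ (measurableTypeR R) mu _ _ _ _ _ mE kint kC mb b_ge0 aint.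
  move=> q; rewrite patchE; case: ifPn; rewrite ?eqxx//.
  rewrite inE/= in_itv/= => /andP[q0 q1] _; rewrite patchE ifT ?inE/= ?in_itv/= ?q0//.
  rewrite /A fineK; last first.
    apply: integrable_fin_num => //; apply: integrableS in_N_integrable => //.
    by move=> x /=; apply: subitvP; rewrite subitvE !bnd_simp// ltW.
  rewrite /Aint integral_mkcond; apply: eq_integral => s _.
  transitivity ((alpha \_ `[0, q[) s)%:E; first by rewrite !patchE; case: ifP.
  congr EFin; apply: esym; apply: patch_indicM.
  rewrite Eq /= !in_itv/=; split=> [[/andP[-> _] ->]//|/andP[s0 sq]].
  by rewrite s0 sq (lt_trans sq q1).
rewrite -Rintegral_itv_bndo_bndc; last first.
  by apply: bdd01_integrableS (bdd01M bdd01_A bk); rewrite subitvE !bnd_simp.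
rewrite !int01M; congr fine; under eq_integral do rewrite mulrC.
rewrite -H; apply: eq_integral => s _; congr EFin.
rewrite /b patchE; case: ifPn => [|_]; last by rewrite !mul0r.
rewrite inE/= => s01; rewrite patchE ifT ?inE//; congr (_ * _).
move: s01; rewrite in_itv/= => /andP[s0 s1].
rewrite -tail_int_oo// Rintegral_mkcond; apply: eq_Rintegral => q _.
apply: patch_indicM; rewrite Eq/= !in_itv/=; split=> [[/andP[_ ->] ->]//|/andP[sq q1]].
by rewrite sq q1 (le_trans s0 (ltW sq)).
Qed.

(** A nonempty up-set of [[0, 1[] is an interval from its infimum to 1, closed or open on the left.
    Single points have no mass, so the integral is a tail integral in both cases. *)
Lemma Rintegral_upper_ge0 phi (U : set R) : bdd01 phi ->
  (forall u, 0 <= u <= 1 -> 0 <= tail_int phi u) ->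
  U `<=` `[0, 1[ -> (forall s t, U s -> s <= t -> t < 1 -> U t) ->
  0 <= \int[mu]_(s in U) phi s.
Proof.
move=> bphi phi0 U01 Uup; have [->|/set0P[x Ux]] := eqVneq U set0.
  by rewrite Rintegral_set0.
have lU : lbound U 0 by move=> y /U01/=; rewrite in_itv/= => /andP[].
have hU : has_inf U by split; [exists x|exists 0].
have u0 : 0 <= inf U by apply: lb_le_inf => //; exists x.
have uU t : inf U < t -> t < 1 -> U t.
  move=> /(inf_lt hU.1)[y Uy yt] t1; exact: (Uup _ _ Uy (ltW yt) t1).
have Uu t : U t -> inf U <= t < 1.
  move=> Ut; rewrite ge_inf//=; last by exists 0.
  by have /U01/= := Ut; rewrite in_itv/= => /andP[].
have u1 : inf U <= 1 by have /andP[ux x1] := Uu _ Ux; rewrite (le_trans ux (ltW x1)).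
have [Uinf|nUinf] := pselect (U (inf U)).
  rewrite (_ : U = `[inf U, 1[%classic) ?tail_int_bndo ?phi0 ?u0//.
  apply/seteqP; split=> t /=; first by rewrite in_itv/=; exact: Uu.
  by rewrite in_itv/= => /andP[it t1]; exact: Uup it t1.
rewrite (_ : U = `]inf U, 1[%classic) ?tail_int_oo ?phi0 ?u0//.
apply/seteqP; split=> t /=; rewrite in_itv/=; last by move=> /andP[]; exact: uU.
move=> Ut; have /andP[ut ->] := Uu _ Ut; rewrite andbT lt_neqAle ut andbT.
by apply/eqP => e; apply: nUinf; rewrite e.
Qed.

(* Layer cake: [alpha] is an integral of indicators of up-sets of [[0, 1[]. *)
Lemma Rintegral_alpha_ge0 phi : bdd01 phi ->
  (forall u, 0 <= u <= 1 -> 0 <= tail_int phi u) ->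
  0 <= \int[mu]_(s in `[0, 1[) (alpha s * phi s).
Proof.
move=> bphi phi0; have [pint [C pC]] := bdd01_patch bphi.
(* The region under the graph of [b]: its section at [s] is [[0, b s[], of length [b s]. *)
pose E := (fun z : R * R => b z.1 - z.2) @^-1` `]0, +oo[ `&`
  (snd @^-1` `[0, +oo[).
have Eq s t : E (s, t) <-> 0 <= t < b s.
  rewrite /E/= !in_itv/= !andbT subr_gt0; split=> [[-> ->]//|/andP[]//].
have mE : measurable E.
  apply: measurableI; rewrite -[X in measurable X]setTI.
    by apply: measurable_funB => //; exact: (measurableT_comp mb).
  exact: measurable_snd.
have mc : measurable_fun setT (cst (1 : R) : R -> R) by exact: measurable_cst.
have [|_ H] := @weighted_fubini R _ (measurableTypeR R) mu _ _ _ _ _ mE pint pC mc (fun=> ler01) b_int.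
  move=> s _; under eq_integral do rewrite mul1r.
  transitivity (mu `[0, b s[%classic).
    rewrite lebesgue_measure_itv/= lte_fin.
    have := b_ge0 s; rewrite le_eqVlt => /predU1P[<-|->]; first by rewrite ltxx.
    by rewrite oppr0 adde0.
  rewrite -[X in mu X]setIT -integral_indic//; apply: eq_integral => t _; congr EFin.
  rewrite !indicE; congr ((nat_of_bool _)%:R).
  by apply/idP/idP; rewrite !inE/= in_itv/= => /Eq.
rewrite (@eq_Rintegral _ _ _ mu _ (fun s => phi s * alpha s)); last by move=> s _; rewrite mulrC.
rewrite int01M -H; apply: fine_ge0; apply: integral_ge0 => t _.
rewrite lee_fin mul1r.
(* The section at level [t]; it is an up-set because [alpha] is nondecreasing. *)
pose U := [set s | 0 <= s < 1 /\ 0 <= t < alpha s].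
rewrite (@eq_Rintegral _ _ _ mu _ (phi \_ U)); last first.
  move=> s _; apply: patch_indicM; rewrite Eq /U/= in_itv/= /b patchE.
  split=> -[s01]; rewrite ifT ?inE/= ?in_itv//.
rewrite -Rintegral_mkcond; apply: Rintegral_upper_ge0 => // [s [+ _]|s s']; first by rewrite /= in_itv.
move=> [/andP[s0 s1] /andP[t0 ts]] ss' s'1; split.
  by rewrite (le_trans s0 ss').
by rewrite t0 (lt_le_trans ts)// and.
Qed.

End Density.

(** * The measure [nu] with distribution function [alpha] *)

Section Distribution.
Context {R : realType}.
Notation mu := (@lebesgue_measure R).

Lemma bigcup_itv01 : \bigcup_n `[0, 1 - n.+1%:R^-1]%classic = `[0, 1[%classic :> set R.
Proof.
apply/seteqP; split=> x.
  move=> [n _]; rewrite /= !in_itv/= => /andP[-> /le_lt_trans]; apply.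
  by rewrite gtrBl invr_gt0.
rewrite /= in_itv/= => /andP[x0 x1].
have /archi_boundP : 0 <= (1 - x)^-1 by rewrite invr_ge0 subr_ge0 ltW.
set n := Num.Def.archi_bound _ => nx.
exists n => //; rewrite /= in_itv/= x0/= lerBrDr -lerBrDl.
rewrite -[leRHS]invrK lef_pV2 ?posrE ?invr_gt0 ?subr_gt0//.
by rewrite (le_trans (ltW nx))// ler_nat.
Qed.

Lemma onemV_itv01 n : 0 <= 1 - (n.+1%:R^-1 : R) < 1.
Proof. by rewrite subr_ge0 invf_le1// ler1n/= gtrBl invr_gt0. Qed.

Variables (alpha : R -> R) (nu : {measure set R -> \bar R}).
Hypothesis aN : in_N alpha.
Hypothesis aI : (Aint alpha 1 < +oo)%E.
Hypothesis nuE : forall s : R, 0 <= s < 1 -> nu `[0, s]%classic = (alpha s)%:E.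

Let mI : measurable (`[0%R, 1%R[%classic : set R) := measurable_itv _.
(** The values of [nu] outside [[0, 1[] are unconstrained. Its restriction is sigma-finite even if
    [nu [0, 1[] is infinite, since each [[0, 1 - 1/(n+1)]] has finite mass and the complement of
    [[0, 1[] becomes null. *)
Let nuI := mrestr nu mI.

HB.instance Definition _ := Measure.on nuI.

Let nuI_sigma_finite : sigma_finite setT nuI.
Proof.
exists (fun n => ~` `[0, 1[ `|` `[0, (1 - n.+1%:R^-1)]).
  apply/esym; rewrite -subTset => x _.
  have [x01|x01] := pselect (`[0, 1[%classic x); last by exists 0%N => //; left.
  by move: x01; rewrite -bigcup_itv01 => -[n _ xn]; exists n => //; right.
move=> n; split; first by apply: measurableU => //; exact: measurableC.
rewrite /nuI /mrestr setIUl setICl set0U.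
rewrite setIidl; first by rewrite nuE ?ltry// onemV_itv01.
by rewrite -bigcup_itv01 => x xn; exists n.
Qed.

HB.instance Definition _ :=
  @Measure_isSigmaFinite.Build _ _ _ nuI nuI_sigma_finite.

(** As [alpha s] is the mass of [[0, s]], Fubini turns the integral of [alpha * phi] into the
    [nu]-integral of the tail integral of [phi]. That integrand is nonnegative, so the integral is
    at most 0 only if the integrand vanishes almost everywhere. *)
Lemma Rintegral_distribution_le0 phi : bdd01 phi ->
  (forall u, 0 <= u <= 1 -> 0 <= tail_int phi u) ->
  let S := [set u | 0 <= u < 1 /\ tail_int phi u = 0] in
  measurable S /\
  (\int[mu]_(s in `[0, 1[) (alpha s * phi s) <= 0 <-> nu (`[0, 1[ `\` S) = 0%E).
Proof.
move=> bphi phi0 S; have [pint [C pC]] := bdd01_patch bphi.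
(* The inequality [t <= s] is not strict because [nuE] concerns closed intervals. *)
pose E := (fun z : R * R => z.1 - z.2) @^-1` `[0, +oo[.
have Eq s t : E (s, t) <-> t <= s by rewrite /E/= in_itv/= andbT subr_ge0.
have mE : measurable E.
  by rewrite -[E]setTI; apply: measurable_funB.
have b_int : mu.-integrable setT (EFin \o (alpha \_ `[0, 1[)).
  rewrite -restrict_EFin; apply/integrable_restrict => //=; rewrite setTI.
  exact: in_N_integrable.
have mc : measurable_fun setT (cst (1 : R) : R -> R) by exact: measurable_cst.
have [|] := @weighted_fubini R _ _ nuI _ _ _ _ _ mE pint pC mc (fun=> ler01) b_int.
  move=> s; rewrite patchE; case: ifPn; rewrite ?eqxx// inE/= => s01 _.
  rewrite patchE ifT ?inE//; under eq_integral do rewrite mul1r.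
  rewrite (_ : (fun t => _) = (fun t => (\1_(xsection E s) t)%:E)); last first.
    by apply/funext => t; rewrite !indicE mem_xsection.
  rewrite integral_indic//; last exact: measurable_xsection.
  rewrite setIT /nuI /mrestr -nuE; last by move: s01; rewrite in_itv.
  congr (nu _); apply/seteqP; split=> t/=; rewrite !in_itv/=.
    move=> /andP[t0 ts]; move: s01; rewrite in_itv/= => /andP[s0 s1].
    by split; [rewrite /xsection/= inE; exact/Eq|rewrite t0 (le_lt_trans ts)].
  by rewrite /xsection/= inE => -[/Eq ts /andP[-> _]].
set h := fun t => \int[mu]_s ((phi \_ `[0, 1[) s * \1_E (s, t)).
move=> ih1 H1.
have ih : nuI.-integrable setT (EFin \o h).
  by apply: eq_integrable ih1 => // t _ /=; rewrite mul1r.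
have H : (\int[nuI]_t (h t)%:E =
    \int[mu]_s ((phi \_ `[0, 1[) s * (alpha \_ `[0, 1[) s)%:E)%E.
  by rewrite -H1; apply: eq_integral => t _; rewrite mul1r.
have mh : measurable_fun setT (EFin \o h) by exact: measurable_int ih.
(* Holds for every real [t]: outside [[0, 1[] too, the section is an up-set of [[0, 1[]. *)
have h0 t : 0 <= h t.
  rewrite /h; pose U := [set s | 0 <= s < 1 /\ t <= s].
  rewrite (@eq_Rintegral _ _ _ mu _ (phi \_ U)); last first.
    by move=> s _; apply: patch_indicM; rewrite Eq /U/= in_itv.
  rewrite -Rintegral_mkcond; apply: Rintegral_upper_ge0 => // [s [+ _]|s s'].
    by rewrite /= in_itv.
  move=> [/andP[s0 s1] ts] ss' s'1; split; last exact: le_trans ts ss'.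
  by rewrite (le_trans s0 ss').
have hE t : 0 <= t < 1 -> h t = tail_int phi t.
  move=> /andP[t0 t1]; rewrite -tail_int_bndo// Rintegral_mkcond.
  apply: eq_Rintegral => s _; apply: patch_indicM.
  rewrite Eq /= !in_itv/=; split=> [[/andP[_ ->] ->]//|/andP[ts ->]].
  by rewrite ts (le_trans t0 ts).
have mZ : measurable (h @^-1` [set 0]).
  rewrite -[X in measurable X]setTI; have /measurable_EFinP := mh; apply => //.
have SE : S = `[0, 1[ `&` (h @^-1` [set 0]).
  apply/seteqP; split=> t /=; rewrite in_itv/= => -[t01]; rewrite hE//.
have DE : `[0, 1[ `\` S = ~` (h @^-1` [set 0]) `&` `[0, 1[.
  by rewrite SE setDIr setDv set0U setIC setDE setIC.
split; first by rewrite SE; exact: measurableI.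
have -> : \int[mu]_(s in `[0, 1[) (alpha s * phi s) = fine (\int[nuI]_t (h t)%:E)%E.
  rewrite H Rintegral_mkcond; congr fine; apply: eq_integral => s _; congr EFin.
  by rewrite !patchE; case: ifP => _; rewrite ?mul0r// mulrC.
have hfin : (\int[nuI]_t (h t)%:E \is a fin_num)%E by exact: integrable_fin_num ih.
have hge0 : (0 <= \int[nuI]_t (h t)%:E)%E by apply: integral_ge0 => t _; rewrite lee_fin.
have -> : (fine (\int[nuI]_t (h t)%:E)%E <= 0 <-> (\int[nuI]_t (h t)%:E = 0)%E).
  rewrite -lee_fin fineK//; split=> [h1|->//]; apply/eqP.
  by rewrite eq_le h1.
have -> : (\int[nuI]_t (h t)%:E = \int[nuI]_t `|(EFin \o h) t|)%E.
  by apply: eq_integral => t _ /=; rewrite ger0_norm.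
(* The integral of [|h|] is zero exactly when [h] vanishes almost everywhere, and the exceptional
   set has [nuI]-measure [nu ([0, 1[ \ S)]. *)
rewrite (ae_eq_integral_abs _ measurableT mh) DE.
have -> : nu (~` (h @^-1` [set 0]) `&` `[0, 1[) = nuI (~` (h @^-1` [set 0])) by [].
rewrite -(negligibleP nuI (measurableC mZ)).
rewrite /ae_eq /almost_everywhere /=.
suff <- : [set x | [set: R] x -> (h x)%:E = 0%E] = h @^-1` [set 0] by [].
by apply/seteqP; split=> t /= ht; [have [] := ht Logic.I|rewrite ht].
Qed.

(** Continuity from below along the intervals [[0, 1 - 1/(n+1)]]: an upper bound for [alpha] on [[0,
    1[] also bounds the total mass. *)
Lemma nu_lty_or_unbounded : (nu `[0%R, 1%R[%classic < +oo)%E \/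
  forall M, exists2 s, 0 <= s < 1 & M < alpha s.
Proof.
have [|nubd] := pselect (forall M, exists2 s, 0 <= s < 1 & M < alpha s); first by right.
left; move/existsNP : nubd => [M /forall2NP aM].
pose F n := `[0, 1 - n.+1%:R^-1]%classic : set R.
apply: (@le_lt_trans _ _ M%:E); last exact: ltry.
have cF : nu \o F @ \oo --> nu `[0, 1[%classic.
  have := @nondecreasing_cvg_mu _ _ _ nu F; rewrite bigcup_itv01; apply => //.
  - by move=> n; exact: measurable_itv.
  - move=> n m nm; apply/subsetPset => x; rewrite /F/= !in_itv/=.
    move=> /andP[-> /le_trans]; apply.
    by rewrite lerD2l lerN2 lef_pV2 ?posrE// ler_nat.
rewrite -(cvg_lim _ cF)//; apply: lime_le.
  by apply/cvg_ex; exists (nu `[0, 1[%classic).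
apply: nearW => n /=; rewrite nuE ?onemV_itv01// lee_fin.
have [|/negP] := aM (1 - n.+1%:R^-1); first by rewrite onemV_itv01.
by rewrite -leNgt.
Qed.

End Distribution.

(** * Sign and linearity of tail integrals *)

Section Tail.
Context {R : realType}.
Notation mu := (@lebesgue_measure R).

(** If the integral were zero, [f] would vanish almost everywhere on []u, 1[], which would make that
    interval a null set, against its length [1 - u]. *)
Lemma tail_int_gt0 (f : R -> R) u : bdd01 f -> 0 <= u < 1 ->
  (forall s, u < s < 1 -> 0 < f s) -> 0 < tail_int f u.
Proof.
move=> bf /andP[u0 u1] f0; rewrite -tail_int_oo//.
have intf : mu.-integrable `]u, 1[ (EFin \o f).
  by apply: bdd01_integrableS => //; rewrite subitvE !bnd_simp u0.
have f_ge0 s : s \in `]u, 1[ -> 0 <= f s by rewrite in_itv/= => /f0/ltW.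
rewrite lt_neqAle Rintegral_ge0 ?andbT//; apply/eqP => /esym f_eq0.
have : (\int[mu]_(s in `]u, 1%R[) `|(EFin \o f) s| = 0)%E.
  have <- : (\int[mu]_(s in `]u, 1%R[) (f s)%:E = 0)%E.
    by rewrite -[RHS]/(0%:E) -f_eq0 fineK//; exact: integrable_fin_num.
  by apply: eq_integral => s; rewrite inE => /f_ge0 fs /=; rewrite ger0_norm.
have mD : measurable (`]u, 1[%classic : set (measurableTypeR R)) by [].
move/(ae_eq_integral_abs mu mD (measurable_int _ intf)) => aef.
have : mu.-negligible `]u, 1[.
  apply: negligibleS aef => s us /= /(_ us) [fs0].
  by have := f0 s; rewrite fs0 ltxx => /(_ us).
move/(negligibleP mu mD) => muD; have : mu `]u, 1[%classic = 0%E by exact: muD.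
rewrite lebesgue_measure_itv/= lte_fin u1 -EFinB => -[] /eqP.
by rewrite subr_eq0 gt_eqF.
Qed.

Lemma tail_intD (f g : R -> R) u : bdd01 f -> bdd01 g -> 0 <= u ->
  tail_int (fun s => f s + g s) u = tail_int f u + tail_int g u.
Proof.
move=> bf bg u0; apply: RintegralD => //;
by apply: bdd01_integrableS => //; rewrite subitvE !bnd_simp u0.
Qed.

Lemma tail_intN (f : R -> R) u : bdd01 f -> 0 <= u ->
  tail_int (fun s => - f s) u = - tail_int f u.
Proof.
move=> bf u0; rewrite /tail_int -mulN1r -RintegralZl//.
  by apply: eq_Rintegral => s _; rewrite mulN1r.
by apply: bdd01_integrableS => //; rewrite subitvE !bnd_simp u0.
Qed.

Lemma tail_int_lt0 (f : R -> R) u : bdd01 f -> 0 <= u < 1 ->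
  (forall s, u < s < 1 -> f s < 0) -> tail_int f u < 0.
Proof.
move=> bf u01 f0; rewrite -oppr_gt0 -tail_intN//; last by case/andP: u01.
by apply: tail_int_gt0 => //; [exact: bdd01N|move=> s /f0; rewrite oppr_gt0].
Qed.

Lemma tail_int_sub (f : R -> R) u : bdd01 f -> 0 <= u <= 1 ->
  \int[mu]_(s in `[0, 1]) f s - \int[mu]_(s in `[0, u]) f s = tail_int f u.
Proof.
move=> bf /andP[u0 u1].
rewrite Rintegral_itvB ?bnd_simp//; last exact: bdd01_integrable.
rewrite Rintegral_itv_obnd_cbnd//.
by apply: bdd01_integrableS => //; rewrite subitvE !bnd_simp u0.
Qed.

End Tail.

(** * The gap [L - A alpha q] and the function [gbar] *)

Section Gbar.
Context {R : realType}.
Notation mu := (@lebesgue_measure R).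
Variables (gamma : R^nat) (h L : R) (alpha : R -> R).
Hypothesis gammaS : summable_gamma gamma.
Hypothesis LaK : in_K L alpha.

Let aN : in_N alpha. Proof. by case: LaK. Qed.

Lemma in_K_lty : (Aint alpha 1 < +oo)%E.
Proof. by case: LaK => _ _ h1; apply: (lt_trans h1); rewrite ltry. Qed.

Let aI := in_K_lty.

Lemma A1_lt : A alpha 1 < L.
Proof.
have [_ _ h1] := LaK; rewrite -lte_fin /A fineK//.
exact: (integrable_fin_num _ (in_N_integrable aN aI)).
Qed.

(** A lower bound uniform in [q]. It makes the denominators positive and controls the remainder of
    the expansion. *)
Lemma gap_ge q : 0 <= q <= 1 -> L - A alpha 1 <= L - A alpha q.
Proof. by move=> /andP[q0 q1]; rewrite lerD2l lerN2 A_nondecreasing. Qed.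

Lemma gap_gt0 q : 0 <= q <= 1 -> 0 < L - A alpha q.
Proof. by move=> /gap_ge; apply: lt_le_trans; rewrite subr_gt0 A1_lt. Qed.

Lemma gap_leL q : 0 <= q <= 1 -> L - A alpha q <= L.
Proof. by move=> /andP[q0 q1]; rewrite gerBl A_ge0. Qed.

Lemma bdd01_gapV : bdd01 (fun q => (L - A alpha q)^-1).
Proof.
apply: bdd01_nondecreasing => s t s0 st t1.
have s01 : 0 <= s <= 1 by rewrite s0 (le_trans st).
have t01 : 0 <= t <= 1 by rewrite t1 (le_trans s0).
by rewrite lef_pV2 ?posrE ?gap_gt0// lerD2l lerN2 A_nondecreasing.
Qed.

Definition gapV2 q := ((L - A alpha q) ^+ 2)^-1.

Lemma bdd01_gapV2 : bdd01 gapV2.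
Proof.
rewrite (_ : gapV2 = (fun q => (L - A alpha q)^-1 * (L - A alpha q)^-1)).
  exact: bdd01M bdd01_gapV bdd01_gapV.
by apply/funext => q; rewrite /gapV2 expr2 invfM.
Qed.

Lemma gapV2_ge0 q : 0 <= gapV2 q.
Proof. by rewrite invr_ge0 sqr_ge0. Qed.

(* The second derivative of [gfun]. *)
Definition kappa q := gapV2 q - xi'' gamma q.

Let bdd01_xi'' : bdd01 (xi'' gamma).
Proof. exact: bdd01_continuous (xi''_continuous gammaS). Qed.

Lemma bdd01_kappa : bdd01 kappa.
Proof. exact: bdd01B bdd01_gapV2 bdd01_xi''. Qed.

Lemma tail_int_xi'' s : 0 <= s <= 1 ->
  tail_int (xi'' gamma) s = xi' gamma 1 - xi' gamma s.
Proof.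
move=> /andP[s0]; rewrite le_eqVlt => /predU1P[->|s1].
  by rewrite tail_int1 subrr.
have sub x : s <= x <= 1 -> `|x| < 2.
  by move=> /andP[sx x1]; rewrite ger0_norm ?(le_trans s0)// (le_lt_trans x1)// ltr1n.
(* Both endpoints lie inside the disc of radius 2, so two-sided continuity supplies the one-sided
   limits. *)
have cxi x : s <= x <= 1 -> {for x, continuous (xi' gamma)}.
  move=> /sub x2; have [d _] := xi'_is_derive gammaS x2.
  by apply: differentiable_continuous; exact/derivable1_diffP.
rewrite /tail_int /Rintegral (@continuous_FTC2 _ _ (xi' gamma))//.
- apply: continuous_subspaceW (xi''_continuous gammaS) => x /=.
  by apply: subitvP; rewrite subitvE !bnd_simp s0.
- split.
  + move=> x /[!in_itv]/= /andP[sx x1]; have [] := @xi'_is_derive _ _ gammaS x => //.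
    by apply: sub; rewrite !ltW.
  + by apply: cvg_at_right_filter; apply: cxi; rewrite lexx ltW.
  + by apply: cvg_at_left_filter; apply: cxi; rewrite lexx ltW.
Qed.

(** [gbar] is an indefinite integral of [- kappa]: the [xi'] part by the fundamental theorem of
    calculus, the other by splitting its integral at [s]. *)
Lemma gbar_tail s : 0 <= s <= 1 ->
  gbar gamma h L alpha s = gbar gamma h L alpha 1 + tail_int kappa s.
Proof.
move=> s01; have /andP[s0 s1] := s01.
rewrite tail_intD ?tail_intN ?tail_int_xi''//; [|exact: bdd01_gapV2|exact: bdd01N].
by rewrite -(tail_int_sub bdd01_gapV2)// /gbar /gapV2; ring.
Qed.

Lemma bdd01_gbar : bdd01 (gbar gamma h L alpha).
Proof.
apply: bdd01B.
  apply: bdd01D; last exact: bdd01_cst.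
  exact: bdd01_continuous (xi'_continuous gammaS).
have int01 t : 0 <= t -> t <= 1 -> mu.-integrable `[0, t] (EFin \o gapV2).
  by move=> t0 t1; apply: bdd01_integrableS bdd01_gapV2; rewrite subitvE !bnd_simp.
apply: bdd01_nondecreasing => s t s0 st t1.
rewrite -subr_ge0 Rintegral_itvB ?bnd_simp//; last exact: int01 (le_trans s0 st) t1.
by apply: Rintegral_ge0 => q _; exact: gapV2_ge0.
Qed.

End Gbar.

(** * Second-order expansion of [Qfun] and the first variation at a minimizer *)

Section Expansion.
Context {R : realType}.
Notation mu := (@lebesgue_measure R).
Variables (gamma : R^nat) (h L : R) (alpha : R -> R).
Hypothesis gammaS : summable_gamma gamma.
Hypothesis LaK : in_K L alpha.

Let aN : in_N alpha. Proof. by case: LaK. Qed.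
Let aI := in_K_lty LaK.

Definition Qrem L' alpha' q :=
  ((L' - A alpha' q) - (L - A alpha q)) ^+ 2 * gapV2 L alpha q * (L' - A alpha' q)^-1.

(* Exact second-order expansion, from [1/y - 1/x = - (y - x)/x^2 + (y - x)^2/(x^2 y)]. *)
Lemma Qfun_expansion L' alpha' : in_K L' alpha' ->
  2 * (Qfun gamma h L' alpha' - Qfun gamma h L alpha) =
  (L' - L) * gbar gamma h L alpha 1
  + \int[mu]_(q in `[0, 1]) ((A alpha' q - A alpha q) * kappa gamma L alpha q)
  + \int[mu]_(q in `[0, 1]) Qrem L' alpha' q.
Proof.
move=> K'; have [_ aN' _] := K'; have aI' := in_K_lty K'.
have bA := bdd01_A aN aI; have bA' := bdd01_A aN' aI'.
have bV := bdd01_gapV LaK; have bV' := bdd01_gapV K'; have bw := bdd01_gapV2 LaK.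
have bx : bdd01 (xi'' gamma) := bdd01_continuous (xi''_continuous gammaS).
have -> : \int[mu]_(q in `[0, 1]) Qrem L' alpha' q =
  \int[mu]_(q in `[0, 1]) ((L' - A alpha' q)^-1 - (L - A alpha q)^-1 +
    ((L' - L) * gapV2 L alpha q - (A alpha' q - A alpha q) * gapV2 L alpha q)).
  apply: eq_Rintegral => q; rewrite inE/= in_itv/= => q01.
  have x0 := lt0r_neq0 (gap_gt0 LaK q01); have x0' := lt0r_neq0 (gap_gt0 K' q01).
  by rewrite /Qrem /gapV2; field; rewrite x0 x0'.
have -> : \int[mu]_(q in `[0, 1]) ((A alpha' q - A alpha q) * kappa gamma L alpha q) =
  \int[mu]_(q in `[0, 1]) ((A alpha' q - A alpha q) * gapV2 L alpha q -
    (xi'' gamma q * A alpha' q - xi'' gamma q * A alpha q)).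
  by apply: eq_Rintegral => q _; rewrite /kappa; ring.
have bAw := bdd01M (bdd01B bA' bA) bw.
have bLw := bdd01M (bdd01_cst (L' - L)) bw.
rewrite (Rintegral01B bAw (bdd01B (bdd01M bx bA') (bdd01M bx bA))).
rewrite (Rintegral01B (bdd01M bx bA') (bdd01M bx bA)).
rewrite (Rintegral01D (bdd01B bV' bV) (bdd01B bLw bAw)).
rewrite (Rintegral01B bV' bV) (Rintegral01B bLw bAw) (Rintegral01Z _ bw).
by rewrite /Qfun /gbar /gapV2; field.
Qed.

(** This is the convexity of [Qfun]: the first-order terms bound its increments from below. *)
Lemma Qrem_ge0 L' alpha' : in_K L' alpha' ->
  0 <= \int[mu]_(q in `[0, 1]) Qrem L' alpha' q.
Proof.
move=> K'; apply: Rintegral_ge0 => q /=; rewrite in_itv/= => q01.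
apply: mulr_ge0; last by rewrite invr_ge0; exact: ltW (gap_gt0 K' q01).
by apply: mulr_ge0; [exact: sqr_ge0|exact: gapV2_ge0].
Qed.

Lemma bdd01_Qrem L' alpha' : in_K L' alpha' -> bdd01 (Qrem L' alpha').
Proof.
move=> K'; have [_ aN' _] := K'; have aI' := in_K_lty K'.
have bA := bdd01_A aN aI; have bA' := bdd01_A aN' aI'.
apply: bdd01M (bdd01_gapV K'); apply: bdd01M (bdd01_gapV2 LaK).
have bdiff := bdd01B (bdd01B (bdd01_cst L') bA') (bdd01B (bdd01_cst L) bA).
exact: (bdd01M bdiff bdiff).
Qed.

(* [a] is the variation of the primitive [A alpha], not of [alpha] itself. *)
Lemma minimizer_variation (l t0 : R) (a : R -> R) (alphat : R -> R -> R) :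
  is_minimizer gamma h L alpha -> bdd01 a -> 0 < t0 ->
  (forall t, 0 < t < t0 -> in_K (L + t * l) (alphat t)) ->
  (forall t q, 0 < t < t0 -> 0 <= q <= 1 -> A (alphat t) q = A alpha q + t * a q) ->
  0 <= l * gbar gamma h L alpha 1
       + \int[mu]_(q in `[0, 1]) (a q * kappa gamma L alpha q).
Proof.
move=> [_ minQ] ba t0_gt0 Kt At.
set d := (X in 0 <= X).
have [C aC] : exists C, forall q, 0 <= q <= 1 -> `|l - a q| <= C.
  by have [_] := bdd01B (bdd01_cst l) ba.
have C0 : 0 <= C by apply: le_trans (aC 0 _); rewrite ?lexx ?ler01.
pose c := L - A alpha 1.
have c0 : 0 < c by rewrite subr_gt0 (A1_lt LaK).
(* [t ^+ 2 * M] bounds the remainder: [C] bounds the variation of the gap, [c] is the smallest gap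
   at [(L, alpha)], and [c / 2] bounds the perturbed gap from below once [t * C <= c / 2]. *)
pose M := C ^+ 2 * (c ^+ 2)^-1 * (c / 2)^-1.
have M0 : 0 <= M.
  apply: mulr_ge0; last by rewrite invr_ge0 ltW// divr_gt0.
  by apply: mulr_ge0; [exact: sqr_ge0|rewrite invr_ge0; exact: sqr_ge0].
have key t : 0 < t < t0 -> t * C <= c / 2 -> 0 <= d + t * M.
  move=> tt tC; have /andP[tgt0 _] := tt; have K' := Kt _ tt.
  have rem q : 0 <= q <= 1 -> Qrem (L + t * l) (alphat t) q <= t ^+ 2 * M.
    move=> q01; rewrite /Qrem At//.
    have -> : L + t * l - (A alpha q + t * a q) - (L - A alpha q) = t * (l - a q) by ring.
    have cx : c <= L - A alpha q := gap_ge LaK q01.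
    have cx' : c / 2 <= L + t * l - (A alpha q + t * a q).
      have : - (t * C) <= t * (l - a q).
        by rewrite -mulrN ler_wpM2l// ?(ltW tgt0)//; have := aC q q01; rewrite ler_norml => /andP[].
      by lra.
    have c2 : 0 < c / 2 by rewrite divr_gt0.
    have y2 : (l - a q) ^+ 2 <= C ^+ 2.
      by rewrite -real_normK ?num_real// lerXn2r ?nnegrE// aC.
    have w2 : gapV2 L alpha q <= (c ^+ 2)^-1.
      rewrite /gapV2 lef_pV2 ?posrE ?exprn_gt0 ?(lt_le_trans c0 cx)//.
      by rewrite lerXn2r ?nnegrE ?(ltW c0) ?(le_trans (ltW c0) cx).
    have v2 : (L + t * l - (A alpha q + t * a q))^-1 <= (c / 2)^-1.
      by rewrite lef_pV2 ?posrE ?(lt_le_trans c2 cx').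
    have -> (y w v : R) : (t * y) ^+ 2 * w * v = t ^+ 2 * (y ^+ 2 * w * v) by ring.
    apply: ler_wpM2l; first exact: sqr_ge0.
    apply: ler_pM => //.
    - by apply: mulr_ge0; [exact: sqr_ge0|exact: gapV2_ge0].
    - by rewrite invr_ge0 (le_trans (ltW c2) cx').
    - by apply: ler_pM => //; [exact: sqr_ge0|exact: gapV2_ge0].
  have := minQ _ _ K'; rewrite -subr_ge0 => /(mulr_ge0 (ler0n R 2)).
  rewrite Qfun_expansion//.
  have -> : \int[mu]_(q in `[0, 1]) ((A (alphat t) q - A alpha q) * kappa gamma L alpha q) =
    t * \int[mu]_(q in `[0, 1]) (a q * kappa gamma L alpha q).
    rewrite -Rintegral01Z; last exact: bdd01M ba (bdd01_kappa gammaS LaK).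
    by apply: eq_Rintegral => q; rewrite inE/= in_itv/= => q01; rewrite At//; ring.
  have := le_Rintegral01 (bdd01_Qrem K') (bdd01_cst _) rem.
  rewrite Rintegral01_cst => h1 h2.
  rewrite -(pmulr_rge0 _ tgt0) /d; apply: le_trans h2 _.
  have -> : L + t * l - L = t * l by ring.
  by move: h1; rewrite expr2; lra.
rewrite leNgt; apply/negP => d0.
(* If [d < 0], this [t] satisfies the two constraints of [key] and makes [t * M] less than
   [- d / 2], so that [d + t * M] is negative. Each [+ 1] keeps a denominator positive. *)
pose t := Num.min (t0 / 2) (Num.min (c / 2 / (C + 1)) (- d / (2 * (M + 1)))).
have C1 : 0 < C + 1 by rewrite ltr_wpDl.
have M1 : 0 < 2 * (M + 1) by rewrite mulr_gt0// ltr_wpDl.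
have tgt0 : 0 < t by rewrite /t !lt_min !divr_gt0// oppr_gt0.
have tt0 : t < t0 by rewrite /t gt_min; apply/orP; left; lra.
have tC : t * C <= c / 2.
  apply: (@le_trans _ _ (t * (C + 1))); first by rewrite ler_wpM2l ?(ltW tgt0)// lerDl.
  by rewrite -ler_pdivlMr// /t !ge_min lexx !orbT.
have tM : t * (2 * (M + 1)) <= - d by rewrite -ler_pdivlMr// /t !ge_min lexx !orbT.
have := key t; rewrite tgt0 tt0 => /(_ isT tC).
by have := mulr_ge0 (ltW tgt0) M0; lra.
Qed.

End Expansion.

(** * Nonnegative combinations of admissible functions *)

Section Combination.
Context {R : realType}.
Notation mu := (@lebesgue_measure R).
Variables (a1 a2 : R -> R) (c1 c2 : R).
Hypotheses (N1 : in_N a1) (N2 : in_N a2) (I1 : (Aint a1 1 < +oo)%E) (I2 : (Aint a2 1 < +oo)%E).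
Hypotheses (c1_ge0 : 0 <= c1) (c2_ge0 : 0 <= c2).

Let a := fun s => c1 * a1 s + c2 * a2 s.

Lemma in_N_comb : in_N a.
Proof.
have [p1 m1 r1] := N1; have [p2 m2 r2] := N2; split.
- by move=> s s01; rewrite addr_ge0// mulr_ge0 ?p1 ?p2.
- by move=> s t s0 st t1; rewrite lerD// ler_wpM2l ?m1 ?m2.
- by move=> s s01; apply: cvgD; apply: cvgM; [exact: cvg_cst|exact: r1|exact: cvg_cst|exact: r2].
Qed.

Let itv_int b q : in_N b -> (Aint b 1 < +oo)%E -> q <= 1 ->
  mu.-integrable `[0, q[ (EFin \o b).
Proof.
move=> Nb Ib q1; apply: integrableS (in_N_integrable Nb Ib) => //.
by move=> x /=; apply: subitvP; rewrite subitvE !bnd_simp.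
Qed.

Let comb_int q : q <= 1 -> mu.-integrable `[0, q[ (EFin \o a).
Proof.
move=> q1; have mD : measurable (`[0, q[%classic : set (measurableTypeR R)) by [].
have i1 := integrableZl mD c1 (itv_int N1 I1 q1).
have i2 := integrableZl mD c2 (itv_int N2 I2 q1).
by apply: eq_integrable (integrableD mD i1 i2).
Qed.

Lemma A_comb q : q <= 1 -> A a q = c1 * A a1 q + c2 * A a2 q.
Proof.
move=> q1; have i1 := itv_int N1 I1 q1; have i2 := itv_int N2 I2 q1.
have mD : measurable (`[0, q[%classic : set (measurableTypeR R)) by [].
rewrite /A /Aint -!/(Rintegral mu _ _) -(RintegralZl c1 mD i1) -(RintegralZl c2 mD i2).
by rewrite -(RintegralD mD (integrableZl mD c1 i1) (integrableZl mD c2 i2)).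
Qed.

Lemma in_K_comb L : 0 < L -> c1 * A a1 1 + c2 * A a2 1 < L -> in_K L a.
Proof.
move=> L0 AL; split => //; first exact: in_N_comb.
rewrite -A_comb// in AL; rewrite -(@fineK _ (Aint a 1)) ?lte_fin//.
exact: integrable_fin_num (comb_int _).
Qed.

End Combination.

(** * Step functions as admissible directions *)

Section Step.
Context {R : realType}.
Notation mu := (@lebesgue_measure R).
Variable u : R.

(** Taking the value 1 at [u] itself makes it right-continuous, as [in_N] demands. Paired with
    [gbar] on [[0, 1[] it gives [gfun] at [u]. *)
Definition step (s : R) : R := if u <= s then 1 else 0.

Let step_nd s t : s <= t -> step s <= step t.
Proof. by rewrite /step => st; case: (leP u s) => [us|_]; [rewrite (le_trans us st)|case: ifP]. Qed.

Lemma in_N_step : in_N step.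
Proof.
split=> [s _|s t _ st _|s _]; [by rewrite /step; case: ifP|exact: step_nd|].
apply: cvg_near_cst; rewrite /step; have [us|su] := leP u s.
  by near=> x; rewrite (le_trans us).
by near=> x; rewrite leNgt [x < u](_ : _ = true)//; near: x; exact: nbhs_right_lt.
Unshelve. all: by end_near. Qed.

Lemma step_lty : (Aint step 1 < +oo)%E.
Proof.
have bs : bdd01 step by apply: bdd01_nondecreasing => s t _ st _; exact: step_nd.
have sint : mu.-integrable `[0, 1[ (EFin \o step).
  by apply: bdd01_integrableS => //; rewrite subitvE !bnd_simp.
exact: integrable_lty sint.
Qed.

End Step.

(** * Necessary and sufficient first-order conditions *)

Section Optimality.
Context {R : realType}.
Notation mu := (@lebesgue_measure R).
Variables (gamma : R^nat) (h L : R) (alpha : R -> R).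
Hypothesis gammaS : summable_gamma gamma.
Hypothesis LaK : in_K L alpha.

Let aN : in_N alpha. Proof. by case: LaK. Qed.
Let aI := in_K_lty LaK.
Let kp := kappa gamma L alpha.
Let gb := gbar gamma h L alpha.
Let L_gt0 : 0 < L. Proof. by case: LaK. Qed.

(** [Rintegral_A_tail] produces the tail integral of [kappa], which is [gbar] once the constant in
    [gbar_tail] vanishes. *)
Lemma Rintegral_A_kappa alpha' : in_N alpha' -> (Aint alpha' 1 < +oo)%E -> gb 1 = 0 ->
  \int[mu]_(q in `[0, 1]) (A alpha' q * kp q) =
  \int[mu]_(s in `[0, 1[) (alpha' s * gb s).
Proof.
move=> N' I' gb1; rewrite (Rintegral_A_tail N' I'); last exact: bdd01_kappa.
apply: eq_Rintegral => s; rewrite inE/= in_itv/= => /andP[s0 s1].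
by rewrite /gb (gbar_tail h gammaS LaK) ?s0 ?ltW// -/gb gb1 add0r.
Qed.

(** With [alpha] fixed, [L] can move both ways while it stays above [A alpha 1]; the range
    [L - A alpha 1] is the distance to that boundary. *)
Lemma minimizer_gbar1 : is_minimizer gamma h L alpha -> gb 1 = 0.
Proof.
move=> mQ.
have A1 := A1_lt LaK; have A1_ge0 : 0 <= A alpha 1 := A_ge0 aN aI ler01 (lexx 1).
have var l : `|l| <= 1 -> 0 <= l * gb 1.
  rewrite ler_norml => /andP[l1 l2].
  have := @minimizer_variation _ gamma h L alpha gammaS LaK l (L - A alpha 1) (cst 0)
    (fun=> alpha) mQ (bdd01_cst 0).
  rewrite subr_gt0 A1 => /(_ isT) /=.
  under eq_Rintegral do rewrite mul0r.
  rewrite Rintegral01_cst addr0; apply.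
    move=> t /andP[t0 t1]; have tl : - t <= t * l by rewrite -[leLHS]mulrN1 ler_wpM2l// ltW.
    split => //; first by lra.
    rewrite -(@fineK _ (Aint alpha 1)) -/(A alpha 1) ?lte_fin; first by lra.
    exact: (integrable_fin_num _ (in_N_integrable aN aI)).
  by move=> t q _ _; rewrite mulr0 addr0.
apply/eqP; rewrite eq_le; apply/andP; split.
  by have := var (-1); rewrite normrN normr1 lexx mulN1r oppr_ge0; apply.
by have := var 1; rewrite normr1 lexx mul1r; apply.
Qed.

Lemma minimizer_gfun_ge0 u : is_minimizer gamma h L alpha -> 0 <= u <= 1 ->
  0 <= gfun gamma h L alpha u.
Proof.
move=> mQ /andP[u0 u1]; have gb1 := minimizer_gbar1 mQ.
have sN := in_N_step u; have sI := step_lty u.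
have a0 : 0 <= A (step u) 1 by apply: A_ge0.
have c0 : 0 < L - A alpha 1 by rewrite subr_gt0 (A1_lt LaK).
have a1 : 0 < A (step u) 1 + 1 by rewrite ltr_wpDl.
(* Adding [t * step u] raises the total integral by [t * A (step u) 1], which must stay below
   [L - A alpha 1]. The [+ 1] covers [u = 1], where [A (step u) 1] is 0. *)
have := @minimizer_variation _ gamma h L alpha gammaS LaK 0
  ((L - A alpha 1) / (A (step u) 1 + 1)) (A (step u))
  (fun t s => 1 * alpha s + t * step u s) mQ (bdd01_A sN sI).
rewrite divr_gt0// => /(_ isT).
rewrite mul0r add0r (Rintegral_A_kappa sN sI gb1).
have -> : \int[mu]_(s in `[0, 1[) (step u s * gb s) = gfun gamma h L alpha u.
  rewrite /gfun -/gb -/(tail_int gb u) -tail_int_bndo//; last exact: bdd01_gbar.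
  rewrite Rintegral_mkcond [RHS]Rintegral_mkcond; apply: eq_Rintegral => s _.
  rewrite !patchE /step; case: ifPn; rewrite ?inE ?notin_setE/= !in_itv/=.
    move=> /andP[s0 s1]; have [us|su] := leP u s.
      by rewrite mul1r ifT// inE/= in_itv/= us.
    by rewrite mul0r ifF//; apply/negP; rewrite inE/= in_itv/= leNgt su.
  move=> ns; rewrite ifF//; apply/negP; rewrite inE/= in_itv/= => /andP[us s1].
  by apply: ns; rewrite s1 (le_trans u0 us).
apply.
  move=> t /andP[t0 tl]; rewrite mulr0 addr0; apply: in_K_comb => //; first exact: ltW.
  move: tl; rewrite ltr_pdivlMr// mul1r mulrDr mulr1 => tl.
  by lra.
move=> t q /andP[t0 _] /andP[q0 q1]; rewrite A_comb ?mul1r//.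
Qed.

Lemma minimizer_int_le0 : is_minimizer gamma h L alpha ->
  \int[mu]_(s in `[0, 1[) (alpha s * gb s) <= 0.
Proof.
move=> mQ; have gb1 := minimizer_gbar1 mQ; have bA := bdd01_A aN aI.
rewrite -(Rintegral_A_kappa aN aI gb1) -oppr_ge0.
(* Shrinking [alpha] by the factor [1 - t] stays admissible for [t < 1]. The term [0 * alpha s]
   gives it the shape of [A_comb]. *)
have := @minimizer_variation _ gamma h L alpha gammaS LaK 0 1 (fun q => - A alpha q)
  (fun t s => (1 - t) * alpha s + 0 * alpha s) mQ (bdd01N bA) ltr01.
rewrite mul0r add0r.
have -> : \int[mu]_(q in `[0, 1]) (- A alpha q * kp q) =
    - \int[mu]_(q in `[0, 1]) (A alpha q * kp q).
  rewrite -mulN1r -Rintegral01Z; last exact: bdd01M bA (bdd01_kappa gammaS LaK).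
  by apply: eq_Rintegral => q _; rewrite mulN1r mulNr.
apply.
  move=> t /andP[t0 t1]; rewrite mulr0 addr0; apply: in_K_comb => //.
    by rewrite subr_ge0 ltW.
  rewrite mul0r addr0 (le_lt_trans _ (A1_lt LaK))// ler_piMl ?A_ge0//.
  by rewrite gerBl ltW.
move=> t q /andP[t0 t1] /andP[q0 q1]; rewrite A_comb//; ring.
Qed.

(** By the expansion, twice the increment of [Qfun] is at least the integral of [alpha' * gbar]
    minus that of [alpha * gbar]. The former is nonnegative by the layer-cake lemma, the latter is
    at most 0. *)
Lemma optimality_sufficient : gb 1 = 0 ->
  (forall u, 0 <= u <= 1 -> 0 <= gfun gamma h L alpha u) ->
  \int[mu]_(s in `[0, 1[) (alpha s * gb s) <= 0 ->
  is_minimizer gamma h L alpha.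
Proof.
move=> gb1 g0 ag; split; first exact: LaK.
move=> L' alpha' K'.
have [_ N' _] := K'; have I' := in_K_lty K'.
rewrite -subr_ge0 -(pmulr_rge0 _ (ltr0n R 2)) (Qfun_expansion _ gammaS LaK K') -/gb gb1.
rewrite mulr0 add0r; apply: addr_ge0; last exact: Qrem_ge0.
have bk := bdd01_kappa gammaS LaK.
under eq_Rintegral do rewrite mulrBl.
rewrite Rintegral01B; [|exact: bdd01M (bdd01_A N' I') bk|exact: bdd01M (bdd01_A aN aI) bk].
rewrite -/kp !Rintegral_A_kappa// subr_ge0; apply: le_trans ag _.
by apply: Rintegral_alpha_ge0 => //; exact: bdd01_gbar.
Qed.

(** Since the gap is at most [L], [gapV2] increases at rate at least [alpha s1 / L ^+ 3] beyond
    [s1], and [xi''] at rate at most [C]; hence the threshold [C * L ^+ 3] for [alpha s1]. *)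
Lemma kappa_increasing_near1 : (forall M, exists2 s, 0 <= s < 1 & M < alpha s) ->
  exists2 s1, 0 <= s1 < 1 & forall p q, s1 <= p -> p < q -> q < 1 -> kp p < kp q.
Proof.
move=> unb; have [C C0 xiC] := xi''_lipschitz gammaS.
have [s1 s101 s1M] := unb (C * L ^+ 3); exists s1 => // p q s1p pq q1.
have /andP[s10 s11] := s101.
have p0 : 0 <= p by exact: le_trans s1p.
have p01 : 0 <= p <= 1 by rewrite p0 ltW// (lt_trans pq).
have q01 : 0 <= q <= 1 by rewrite (ltW q1) (le_trans p0 (ltW pq)).
have mD : measurable (`[p, q[%classic : set (measurableTypeR R)) by [].
have dA : alpha s1 * (q - p) <= A alpha q - A alpha p.
  rewrite (A_sub aN aI)//; [|exact: ltW|exact: ltW].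
  have -> : alpha s1 * (q - p) = \int[mu]_(s in `[p, q[) (alpha s1).
    rewrite Rintegral_cst//; congr (_ * _).
    rewrite [X in fine X](_ : _ = (q - p)%:E)//.
    by rewrite [LHS]lebesgue_measure_itv/= lte_fin pq.
  apply: le_Rintegral => //.
  - by apply: bdd01_integrableS (bdd01_cst _); rewrite subitvE !bnd_simp p0 ltW.
  - apply: integrableS (in_N_integrable aN aI) => //.
    by move=> x /=; apply: subitvP; rewrite subitvE !bnd_simp p0 ltW.
  - move=> s /=; rewrite in_itv/= => /andP[ps sq]; have [_ and _] := aN.
    by apply: and; rewrite ?(le_trans s1p) ?(lt_trans sq).
have := xiC p q p0 (ltW pq) (ltW q1).
rewrite /kp /kappa /gapV2.
set x := L - A alpha p; set y := L - A alpha q.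
have y0 : 0 < y := gap_gt0 LaK q01.
have x0 : 0 < x := gap_gt0 LaK p01.
have xL : x <= L := gap_leL LaK p01.
have xy : alpha s1 * (q - p) <= x - y by rewrite /x /y; lra.
have qp : 0 < q - p by rewrite subr_gt0.
have yx : y < x.
  rewrite -subr_gt0 (lt_le_trans _ xy)// mulr_gt0// (lt_trans _ s1M)//.
  by rewrite mulr_gt0// exprn_gt0.
(* The factor [(x + y) / (x ^+ 2 * y ^+ 2)] is at least [x ^- 3], because [0 < y < x], and
   [x <= L]. *)
have gain : (x - y) * (L ^+ 3)^-1 <= (y ^+ 2)^-1 - (x ^+ 2)^-1.
  have -> : (y ^+ 2)^-1 - (x ^+ 2)^-1 = (x - y) * ((x + y) / (x ^+ 2 * y ^+ 2)).
    by field; rewrite !lt0r_neq0.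
  rewrite ler_wpM2l ?subr_ge0 ?(ltW yx)//.
  apply: (@le_trans _ _ (x ^+ 3)^-1).
    rewrite lef_pV2 ?posrE ?exprn_gt0//.
    by apply: lerXn2r => //; rewrite nnegrE ltW.
  rewrite ler_pdivlMr; last by rewrite mulr_gt0 ?exprn_gt0.
  have -> : (x ^+ 3)^-1 * (x ^+ 2 * y ^+ 2) = y ^+ 2 / x by field; rewrite lt0r_neq0.
  rewrite ler_pdivrMr// expr2 [leRHS]mulrDl; apply: (@le_trans _ _ (y * x)).
    by rewrite ler_wpM2l ?(ltW y0) ?(ltW yx).
  by rewrite lerDr mulr_ge0 ?(ltW x0).
have : C * (q - p) < (x - y) * (L ^+ 3)^-1.
  rewrite ltr_pdivlMr ?exprn_gt0//; apply: lt_le_trans xy.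
  by rewrite mulrAC ltr_pM2r.
move=> /lt_le_trans /(_ gain) /[swap] /le_lt_trans lt_trans1 /lt_trans1 {lt_trans1 gain}.
move: (xi'' gamma q) (xi'' gamma p) (y ^+ 2)^-1 (x ^+ 2)^-1 => a b c d.
by lra.
Qed.

(* [g'' = kappa] is strictly increasing near [1], where [g] and [g'] vanish; as [g >= 0] this
   forces [g > 0] in a left neighbourhood of [1]. *)
Lemma Sset_away_from1 : gb 1 = 0 ->
  (forall u, 0 <= u <= 1 -> 0 <= gfun gamma h L alpha u) ->
  (forall M, exists2 s, 0 <= s < 1 & M < alpha s) ->
  exists2 q0, 0 <= q0 < 1 & Sset gamma h L alpha `<=` `[0, q0].
Proof.
move=> gb1 g0 unb; have bk := bdd01_kappa gammaS LaK.
have bg : bdd01 gb := bdd01_gbar h gammaS LaK.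
have gbE s : 0 <= s <= 1 -> gb s = tail_int kp s.
  by move=> s01; rewrite /gb (gbar_tail h gammaS LaK)// -/gb gb1 add0r.
have [s1 /andP[s10 s11] kinc] := kappa_increasing_near1 unb.
(* If [kappa] is nonnegative at some [q0] beyond [s1], it is positive on []q0, 1[], and integrating
   twice from 1 gives [gfun > 0] there. *)
have [[q0 /andP[s1q q1] kq]|/forall2NP nk] := pselect (exists2 q, s1 <= q < 1 & 0 <= kp q).
  have q0_ge0 : 0 <= q0 by exact: le_trans s1q.
  exists q0; first by rewrite q0_ge0.
  have gpos s : q0 <= s < 1 -> 0 < gb s.
    move=> /andP[qs s1']; have s0 : 0 <= s by exact: le_trans qs.
    have -> : gb s = tail_int kp s by apply: gbE; rewrite s0 (ltW s1').
    apply: (tail_int_gt0 bk); first by rewrite s0 s1'.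
    move=> t /andP[st t1]; apply: le_lt_trans kq _.
    by apply: kinc => //; exact: le_lt_trans st.
  move=> u [/andP[u0 u1] gu]; rewrite /= in_itv/= u0/= leNgt; apply/negP => qu.
  suff : 0 < gfun gamma h L alpha u by rewrite gu ltxx.
  apply: (tail_int_gt0 bg); first by rewrite u0 u1.
  by move=> s /andP[us s1']; apply: gpos; rewrite s1' andbT ltW// (lt_trans qu).
(* Otherwise [kappa] is negative on all of [[s1, 1[], and integrating twice makes [gfun] negative at
   [s1], a contradiction. *)
have gneg s : s1 <= s < 1 -> gb s < 0.
  move=> /andP[qs s1']; have s0 : 0 <= s by exact: le_trans qs.
  have -> : gb s = tail_int kp s by apply: gbE; rewrite s0 (ltW s1').
  apply: (tail_int_lt0 bk); first by rewrite s0 s1'.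
  move=> t /andP[st t1]; have [//|/negP] := nk t.
    by rewrite t1 (le_trans qs (ltW st)).
  by rewrite -ltNge.
have : gfun gamma h L alpha s1 < 0.
  apply: (tail_int_lt0 bg); first by rewrite s10 s11.
  by move=> s /andP[us s1']; apply: gneg; rewrite s1' ltW.
by rewrite ltNge g0// s10 ltW.
Qed.

End Optimality.

Theorem theorem2 (R : realType) (gamma : nat -> R) (h L : R) (alpha : R -> R)
  (nu : {measure set R -> \bar R}) :
  summable_gamma gamma ->
  in_K L alpha ->
  (forall s : R, 0 <= s < 1 -> nu `[0, s]%classic = (alpha s)%:E) ->
  (is_minimizer gamma h L alpha <->
   [/\ xi' gamma 1 + h ^+ 2
         = \int[lebesgue_measure]_(q in `[0, 1]) ((L - A alpha q) ^+ 2)^-1,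
       (forall u : R, 0 <= u <= 1 -> 0 <= gfun gamma h L alpha u) &
       nu (Sset gamma h L alpha) = nu `[0, 1[%classic ]).
Proof.
move=> gammaS LaK nuE.
have [_ aN _] := LaK; have aI := in_K_lty LaK; have bg := bdd01_gbar h gammaS LaK.
have gb1E : (xi' gamma 1 + h ^+ 2
    = \int[lebesgue_measure]_(q in `[0, 1]) ((L - A alpha q) ^+ 2)^-1)
    <-> gbar gamma h L alpha 1 = 0.
  by rewrite /gbar; split=> [->|/eqP]; [rewrite subrr|rewrite subr_eq0 => /eqP].
have mI : measurable (`[0%R, 1%R[%classic : set R) by exact: measurable_itv.
have SI : Sset gamma h L alpha `<=` `[0, 1[ by move=> u [u01 _]; rewrite /= in_itv.
have dist : (forall u, 0 <= u <= 1 -> 0 <= gfun gamma h L alpha u) ->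
    measurable (Sset gamma h L alpha) /\
    (\int[lebesgue_measure]_(s in `[0, 1[) (alpha s * gbar gamma h L alpha s) <= 0 <->
     nu (`[0, 1[ `\` Sset gamma h L alpha) = 0%E).
  by move=> g0; exact: (Rintegral_distribution_le0 aN aI nuE bg g0).
split=> [mQ|[/gb1E gb1 g0 nuS]].
  have gb1 := minimizer_gbar1 gammaS LaK mQ.
  have g0 u := @minimizer_gfun_ge0 _ _ _ _ _ gammaS LaK u mQ.
  split; [exact/gb1E|exact: g0|].
  have [mS [+ _]] := dist g0.
  move=> /(_ (minimizer_int_le0 gammaS LaK mQ)) nuD.
  have -> : nu `[0%R, 1%R[%classic = (nu (`[0%R, 1%R[ `\` Sset gamma h L alpha) +
      nu (`[0%R, 1%R[ `&` Sset gamma h L alpha))%E by exact: measureDI.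
  by rewrite nuD add0e setIidr.
have [mS [_ nuD]] := dist g0.
(* Finiteness is what allows subtracting [nu S] below. In the unbounded case [S] lies in some
   [[0, q0]], whose mass is the real number [alpha q0]. *)
have nuI : (nu `[0%R, 1%R[%classic < +oo)%E.
  have [//|unb] := nu_lty_or_unbounded nuE.
  have [q0 q01 Sq] := Sset_away_from1 gammaS LaK gb1 g0 unb.
  rewrite -nuS; apply: (@le_lt_trans _ _ (nu `[0, q0]%classic)).
    by apply: le_measure; rewrite ?inE//; exact: measurable_itv.
  by rewrite nuE// ltry.
apply: (optimality_sufficient gammaS LaK gb1 g0); apply: nuD.
have -> : nu (`[0%R, 1%R[ `\` Sset gamma h L alpha) = (nu `[0%R, 1%R[%classic -
    nu (`[0%R, 1%R[ `&` Sset gamma h L alpha))%E by exact: measureD.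
by rewrite setIidr// nuS subee// ge0_fin_numE.
Qed.
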